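(* Let $r\geq 3$ and $n\geq 10^4r^3$ be integers. If $G$ is a graph on $n$ vertices with minimum degree $\delta(G)\geq \left(1-\frac{1}{10^4r^{3/2}}\right)n$, then $G$ has a fractional $K_r$-decomposition.
   Context: For a graph $F$ and a graph $G$, let $\mathcal F(G)$ denote the set of copies of $F$ in $G$. A fractional $F$-decomposition of $G$ is a function $\omega:\mathcal F(G)\to[0,1]$ such that for every edge $e\in E(G)$, $\sum_{F'\in\mathcal F(G):\, e\in E(F')}\omega(F')=1$. $K_r$ denotes the complete graph on $r$ vertices. *)

(* Defs.v *)
From HB Require Import structures.
From mathcomp Require Import all_boot all_order all_algebra.
From mathcomp Require Import reals exp.

Set Implicit Arguments.
Unset Strict Implicit.
Unset Printing Implicit Defensive.

Import Order.TTheory GRing.Theory Num.Theory.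

Record sgraph := SGraph {
  vertex :> finType;
  adj : rel vertex;
  adj_sym : symmetric adj;
  adj_irrefl : irreflexive adj
}.

Definition edges (G : sgraph) : {set {set G}} :=
  [set [set p.1; p.2] | p : G * G & adj p.1 p.2].

Definition degree (G : sgraph) (v : G) : nat := #|[set u : G | adj v u]|.

(* The default value #|G| only matters when G has no vertices, since every
   degree is smaller than #|G|. *)
Definition min_degree (G : sgraph) : nat := \big[minn/#|G|]_(v : G) degree v.

Definition complete_adj (r : nat) : rel 'I_r := fun i j => i != j.

Lemma complete_adj_sym (r : nat) : symmetric (@complete_adj r).
Proof. by move=> i j; rewrite /complete_adj eq_sym. Qed.

Lemma complete_adj_irrefl (r : nat) : irreflexive (@complete_adj r).
Proof. by move=> i; rewrite /complete_adj eqxx. Qed.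

Definition complete_graph (r : nat) : sgraph :=
  SGraph (@complete_adj_sym r) (@complete_adj_irrefl r).

(* A subgraph is a pair (vertex set, edge set), so that two embeddings of F
   with the same image give one and the same copy of F. *)
Definition is_subgraph (G : sgraph) (H : {set G} * {set {set G}}) : bool :=
  (H.2 \subset edges G) && [forall e in H.2, e \subset H.1].

Definition iso_to (F G : sgraph) (H : {set G} * {set {set G}}) : bool :=
  [exists f : {ffun F -> G},
    [&& injectiveb f,
        [set f x | x : F] == H.1 &
        [set [set f x | x in e] | e : {set F} in edges F] == H.2]].

Definition copies (F G : sgraph) : {set {set G} * {set {set G}}} :=
  [set H | is_subgraph H && iso_to F H].

Local Open Scope ring_scope.

(* The values of w outside [copies F G] are irrelevant. *)
Definition fractional_decomposition (R : realType) (F G : sgraph)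
    (w : {set G} * {set {set G}} -> R) : Prop :=
  (forall H, H \in copies F G -> 0 <= w H <= 1) /\
  (forall e, e \in edges G -> \sum_(H in copies F G | e \in H.2) w H = 1).

Definition has_fractional_decomposition (R : realType) (F G : sgraph) : Prop :=
  exists w : {set G} * {set {set G}} -> R, fractional_decomposition F w.

(* Main.v *)
(* Call two vertices in conflict if they are equal or not adjacent; every vertex
   is in conflict with at most [eps * n] vertices, [eps = 10^-4 r^(-3/2)].
   Sample [t = 600 r] vertices independently and uniformly. The conflict graph
   on the sample is subcritical ([eps * t] is of order [r^(-1/2)]), so up to
   probability O((eps t)^4) = O(r^-2) a given sample point lies in a component
   with at most 6 elements. In each such component, independently of the others,
   choose an independent set with at most two elements so that every element has
   probability 1/6 and every independent pair has probability 1/36. Then pairs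
   of adjacent sample points are chosen with probability exactly 1/36, whether
   or not they share a component, and the chosen points span a clique [Q] of [G]
   which has at least [r + 2] vertices up to an exponentially small probability.
   Hence all edges of [G] lie in the random clique [Q] with the same probability
   up to a relative error 1/(r (r + 1)). Such a small error can be corrected
   inside each [Q]: a weighting of the edges of K_(r+2) with values in
   [1, 1 + 1/(r (r + 1))] is a nonnegative combination of r-cliques, because the
   explicit solution of the corresponding (Kneser) linear system is nonnegative. *)
Require Import Defs.
From mathcomp Require Import all_boot all_order all_algebra.
From mathcomp Require Import reals exp.
From mathcomp Require Import ring lra zify.

Set Implicit Arguments.
Unset Strict Implicit.
Unset Printing Implicit Defensive.

Import Order.TTheory GRing.Theory Num.Theory.

Local Open Scope ring_scope.

(** * Edge weightings generated by cliques *)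

Lemma sum_boolM (R : pzSemiRingType) (T : finType) (a : T) (g : T -> R) :
  \sum_s (s == a)%:R * g s = g a.
Proof.
rewrite (bigD1 a) //= eqxx mul1r big1 ?addr0 // => s /negbTE ->.
by rewrite mul0r.
Qed.

Section CliqueCone.

Variables (R : realFieldType) (G : sgraph).
Implicit Types (x y : G) (S Q : {set G}) (f : G -> G -> R).

Definition clique S :=
  [forall x in S, forall y in S, (x != y) ==> adj x y].

Lemma cliqueP S :
  reflect {in S &, forall x y, x != y -> adj x y} (clique S).
Proof.
apply: (iffP idP) => [/forall_inP cS x y xS yS xy|cS].
  by move: (cS _ xS) => /forall_inP /(_ _ yS) /implyP; apply.
apply/forall_inP => x xS; apply/forall_inP => y yS; apply/implyP.
exact: cS.
Qed.

Lemma clique_sub S Q : S \subset Q -> clique Q -> clique S.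
Proof.
move=> /subsetP sSQ /cliqueP cQ; apply/cliqueP => x y xS yS.
by apply: cQ; apply: sSQ.
Qed.

(** The convex cone spanned by the edge indicators of the [r]-cliques. Only the values of [f] on
    adjacent pairs matter; a fractional decomposition amounts to the constant [1] lying in this
    cone. *)
Definition clique_cone (r : nat) f :=
  exists2 w : {set G} -> R, forall S, 0 <= w S &
    forall x y, adj x y ->
      \sum_(S : {set G} | [&& #|S| == r, clique S, x \in S & y \in S]) w S = f x y.

Variable r : nat.

Lemma eq_clique_cone f1 f2 :
  (forall x y, adj x y -> f1 x y = f2 x y) ->
  clique_cone r f1 -> clique_cone r f2.
Proof. by move=> f12 [w w0 wE]; exists w => // x y xy; rewrite wE // f12. Qed.

Lemma clique_cone0 : clique_cone r (fun _ _ => 0).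
Proof. by exists (fun=> 0) => // x y _; rewrite big1. Qed.

Lemma clique_coneD f1 f2 : clique_cone r f1 -> clique_cone r f2 ->
  clique_cone r (fun x y => f1 x y + f2 x y).
Proof.
move=> [w1 w10 w1E] [w2 w20 w2E].
exists (fun S => w1 S + w2 S) => [S|x y xy]; first exact: addr_ge0.
by rewrite big_split /= w1E // w2E.
Qed.

Lemma clique_coneZ a f : 0 <= a -> clique_cone r f ->
  clique_cone r (fun x y => a * f x y).
Proof.
move=> a0 [w w0 wE].
exists (fun S => a * w S) => [S|x y xy]; first exact: mulr_ge0.
by rewrite -mulr_sumr wE.
Qed.

Lemma clique_cone_sum (I : Type) (s : seq I) (P : pred I) (F : I -> G -> G -> R) :
  (forall i, P i -> clique_cone r (F i)) ->
  clique_cone r (fun x y => \sum_(i <- s | P i) F i x y).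
Proof.
move=> FP; elim: s => [|i s IH].
  by apply: eq_clique_cone clique_cone0 => x y _; rewrite big_nil.
case Pi: (P i); last first.
  by apply: eq_clique_cone IH => x y _; rewrite big_cons Pi.
apply: eq_clique_cone (clique_coneD (FP i Pi) IH) => x y _.
by rewrite big_cons Pi.
Qed.

(* The weights [u a b] invert the Kneser-type system
   [\sum_(ab disjoint from xy) u ab = f xy] on the pairs of [Q]. *)
Lemma clique_cone_clique_addn2 Q f :
  (1 < r)%N -> clique Q -> #|Q| = r.+2 -> (forall x y, f x y = f y x) ->
  (forall x y, adj x y -> 1 <= f x y <= 1 + (r%:R * r.+1%:R)^-1) ->
  clique_cone r (fun x y => ((x \in Q) && (y \in Q))%:R * f x y).
Proof.
move=> r1 cQ szQ fC fB.
have r0R : 1 < r%:R :> R by rewrite ltr1n.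
have rn1 : r%:R - 1 != 0 :> R by rewrite gt_eqF // subr_gt0.
have rn0 : r%:R != 0 :> R by rewrite gt_eqF //; lra.
have rp1 : r%:R + 1 != 0 :> R by rewrite gt_eqF //; lra.
pose F a := \sum_(b in Q :\ a) f a b.
pose T := \sum_(a in Q) F a.
(* [u a b] becomes the weight of the [r]-clique [Q :\ a :\ b]. By inclusion-exclusion, the sum over
   the pairs disjoint from [x], [y] is the total, minus the row sums at [x] and [y], plus [u x y];
   solving for the row sums and the total gives this formula. [T] runs over ordered pairs. *)
pose u a b := f a b - (F a + F b) / (r%:R - 1) + T / (r%:R * (r%:R - 1)).
have uC a b : u a b = u b a by rewrite /u fC (addrC (F a)).
have szQ1 a : a \in Q -> #|Q :\ a| = r.+1.
  by move=> aQ; move: szQ; rewrite (cardsD1 a) aQ add1n => -[].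
have adjQ a b : a \in Q -> b \in Q :\ a -> adj a b.
  move=> aQ; rewrite !inE => /andP[ba bQ].
  by move/cliqueP: cQ; apply; rewrite // eq_sym.
have sumQ1 a c : a \in Q -> \sum_(b in Q :\ a) c = r.+1%:R * c :> R.
  by move=> aQ; rewrite sumr_const szQ1 // mulr_natl.
have sumQ c : \sum_(b in Q) c = r.+2%:R * c :> R.
  by rewrite sumr_const szQ mulr_natl.
pose d : R := (r%:R * r.+1%:R)^-1.
have F_ub a : a \in Q -> F a <= r.+1%:R * (1 + d).
  move=> aQ; rewrite -(sumQ1 a) //; apply: ler_sum => b bQ.
  by case/andP: (fB _ _ (adjQ _ _ aQ bQ)).
have F_lb a : a \in Q -> r.+1%:R <= F a.
  move=> aQ; rewrite -[leLHS]mulr1 -(sumQ1 a) //; apply: ler_sum => b bQ.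
  by case/andP: (fB _ _ (adjQ _ _ aQ bQ)).
have T_lb : r.+2%:R * r.+1%:R <= T.
  by rewrite -sumQ; apply: ler_sum.
have u0 a b : a \in Q -> b \in Q :\ a -> 0 <= u a b.
  move=> aQ bQ; have /andP[f1 _] := fB _ _ (adjQ _ _ aQ bQ).
  have bQ' : b \in Q by move: bQ; rewrite !inE => /andP[].
  have h1 : (F a + F b) / (r%:R - 1) <= 2 * r.+1%:R * (1 + d) / (r%:R - 1).
    rewrite ler_pM2r ?invr_gt0 ?subr_gt0 //.
    by have := F_ub _ aQ; have := F_ub _ bQ'; lra.
  have h2 : r.+2%:R * r.+1%:R / (r%:R * (r%:R - 1)) <= T / (r%:R * (r%:R - 1)).
    by rewrite ler_pM2r // invr_gt0 mulr_gt0 ?subr_gt0 //; lra.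
  (* Extreme case: [f a b] minimal, [F a] and [F b] maximal, [T] minimal. The value is exactly 0,
     which is how the width [d] of the allowed interval is calibrated. *)
  have h3 : 1 - 2 * r.+1%:R * (1 + d) / (r%:R - 1) +
      r.+2%:R * r.+1%:R / (r%:R * (r%:R - 1)) = 0 :> R.
    rewrite /d -[r.+2]addn2 -[r.+1]addn1 !natrD; field.
    by rewrite rn1 rn0 rp1.
  rewrite /u; lra.
have UE a : a \in Q ->
    \sum_(b in Q :\ a) u a b = - F a / (r%:R - 1) + T / (r%:R * (r%:R - 1)).
  move=> aQ; rewrite /u big_split /= sumrB -/(F a) sumQ1 //.
  rewrite -mulr_suml big_split /= sumQ1 //.
  have -> : \sum_(b in Q :\ a) F b = T - F a.
    by apply/eqP; rewrite eq_sym subr_eq addrC -big_setD1.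
  rewrite -[r.+1]addn1 natrD; field.
  by rewrite ?rn1 ?rn0.
have UT : \sum_(a in Q) \sum_(b in Q :\ a) u a b = 2 * T / (r%:R * (r%:R - 1)).
  rewrite (eq_bigr _ UE) big_split /= sumQ -mulr_suml sumrN -/T.
  rewrite -[r.+2]addn2 natrD; field.
  by rewrite ?rn1 ?rn0.
(* Every unordered pair is met in both orders, hence the factor [2^-1]. *)
exists (fun S => 2^-1 * \sum_(a in Q) \sum_(b in Q :\ a)
          (S == Q :\ a :\ b)%:R * u a b) => [S|x y xy].
  rewrite mulr_ge0 ?invr_ge0 // sumr_ge0 // => a aQ.
  by rewrite sumr_ge0 // => b bQ; rewrite mulr_ge0 // u0.
rewrite -mulr_sumr exchange_big /=.
under eq_bigr => a aQ.
  rewrite exchange_big /=.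
  under eq_bigr => b bQ.
    rewrite big_mkcond /=.
    rewrite (eq_bigr (fun S => (S == Q :\ a :\ b)%:R *
      (((x \in S) && (y \in S))%:R * u a b))); last first.
      move=> S _; case: (S =P Q :\ a :\ b) => [->|_]; last first.
        by rewrite !mul0r if_same.
      have -> : #|Q :\ a :\ b| == r.
        by apply/eqP; move: (szQ1 a aQ); rewrite (cardsD1 b) bQ add1n => -[].
      rewrite (@clique_sub _ Q) //=; last first.
        by apply/subsetP => z; rewrite !inE => /and3P[].
      by case: ifP; rewrite !(mul1r, mul0r).
    rewrite sum_boolM.
    over.
  over.
have xny : x != y by apply: contraTneq xy => ->; rewrite adj_irrefl.
case xyQ: ((x \in Q) && (y \in Q)); last first.
  rewrite mul0r big1 ?mulr0 // => a aQ; rewrite big1 // => b bQ.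
  by rewrite !inE; case: (x \in Q) xyQ => [/= ->|_]; rewrite !andbF ?mul0r.
rewrite mul1r; case/andP: xyQ => xQ yQ.
pose Q' := Q :\ x :\ y.
have yQx : y \in Q :\ x by rewrite !inE eq_sym xny.
have xQy : x \in Q :\ y by rewrite !inE xny.
have sumQ' (g : G -> R) : \sum_(a in Q') g a = \sum_(a in Q) g a - g x - g y.
  by rewrite [in RHS](big_setD1 x) //= (big_setD1 y yQx) /= -/Q'; ring.
(* Terms with [a] or [b] in [{x, y}] vanish, since then [Q :\ a :\ b] misses [x] or [y]. What
   remains is expressed by full row sums, already computed in [UE] and [UT]. *)
transitivity (2^-1 * \sum_(a in Q') (\sum_(b in Q :\ a) u a b - u a x - u a y)).
  congr (_ * _); rewrite (big_setD1 x) //= [X in X + _]big1 ?add0r; last first.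
    by move=> b _; rewrite !inE eqxx !(andbF, andFb) mul0r.
  rewrite (big_setD1 y) //= [X in X + _]big1 ?add0r; last first.
    by move=> b _; rewrite !inE eqxx !(andbF, andFb) mul0r.
  apply: eq_bigr => a; rewrite !inE => /and3P[ay ax aQ].
  have xa : x \in Q :\ a by rewrite !inE eq_sym ax.
  have ya : y \in Q :\ a :\ x by rewrite !inE eq_sym xny eq_sym ay.
  rewrite (big_setD1 x) //= (big_setD1 y) //=.
  rewrite [in RHS](big_setD1 x) //= [in RHS](big_setD1 y) //=.
  rewrite !inE !eqxx !(andbF, andFb) !mul0r !add0r.
  rewrite (eq_bigr (u a)) => [|b]; first by ring.
  rewrite !inE => /and4P[by_ bx ba bQ].
  by rewrite ![x == _]eq_sym ![y == _]eq_sym bx by_ ax ay xQ yQ mul1r.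
rewrite !sumrB sumQ' UT (UE x xQ) (UE y yQ) !sumQ'.
under eq_bigr do rewrite uC.
under [X in _ - (X - _ - _)]eq_bigr do rewrite uC.
rewrite (big_setD1 x) //= (UE x xQ) (big_setD1 y) //= (UE y yQ).
rewrite (uC y x) /u; field.
by rewrite ?rn1 ?rn0.
Qed.

(** Averages the previous lemma over all subsets of [Q] with [r.+2] elements; each pair of [Q] lies
    in the same number [N] of them. *)
Lemma clique_cone_clique Q f :
  (1 < r)%N -> clique Q -> (r.+2 <= #|Q|)%N -> (forall x y, f x y = f y x) ->
  (forall x y, adj x y -> 1 <= f x y <= 1 + (r%:R * r.+1%:R)^-1) ->
  clique_cone r (fun x y => ((x \in Q) && (y \in Q))%:R * f x y).
Proof.
move=> r1 cQ szQ fC fB.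
pose P := [pred S : {set G} | (S \subset Q) && (#|S| == r.+2)].
pose N : R := 'C(#|Q|.-2, r)%:R.
have N0 : 0 < N by rewrite ltr0n bin_gt0; case: #|Q| szQ => [|[]].
have := @clique_cone_sum _ (index_enum _) P
  (fun S x y => ((x \in S) && (y \in S))%:R * f x y).
move=> /(_ _)/(clique_coneZ (_ : 0 <= N^-1)) => H.
apply: eq_clique_cone (H _ _) => [x y xy| |S /andP[SQ /eqP szS]]; last 2 first.
- by rewrite invr_ge0 ltW.
- by apply: clique_cone_clique_addn2 => //; apply: clique_sub cQ.
rewrite -mulr_suml mulrA; congr (_ * _).
have xny : x != y by apply: contraTneq xy => ->; rewrite adj_irrefl.
case xyQ: ((x \in Q) && (y \in Q)); last first.
  rewrite big1 ?mulr0 // => S /andP[/subsetP SQ _].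
  case xyS: (_ && _) => //; case/andP: xyS => /SQ xQ /SQ yQ.
  by rewrite xQ yQ in xyQ.
case/andP: xyQ => xQ yQ.
suff -> : \sum_(S | P S) ((x \in S) && (y \in S))%:R = N.
  by rewrite mulVf // gt_eqF.
pose Q' := Q :\ x :\ y.
have szQ' : #|Q'| = #|Q|.-2.
  by rewrite [in RHS](cardsD1 x) xQ (cardsD1 y (Q :\ x)) !inE eq_sym xny yQ.
rewrite /N -szQ' -cards_draws -sum1_card natr_sum.
rewrite [LHS](bigID (fun S : {set G} => (x \in S) && (y \in S))) /= addrC.
rewrite big1 ?add0r => [|S /andP[_ /negbTE->] //].
(* Adding [x] and [y] matches the [r]-subsets of [Q'] with the [r.+2]-subsets of [Q] through both
   points. *)
rewrite (reindex_onto (fun S => x |: (y |: S)) (fun S => S :\ x :\ y)) /=; last first.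
  move=> S /and3P[_ xS yS]; rewrite setD1K ?setD1K // !inE.
  by rewrite eq_sym xny yS.
have key S : [&& (x |: (y |: S) \subset Q) && (#|x |: (y |: S)| == r.+2),
    x \in x |: (y |: S) & y \in x |: (y |: S)]
    && ((x |: (y |: S)) :\ x :\ y == S) = (S \subset Q') && (#|S| == r).
  case xyS: ((x \in S) || (y \in S)).
    transitivity false.
      apply/negbTE; apply/negP => /andP[_ /eqP e].
      by move: xyS; rewrite -e !inE !eqxx !(andbF).
    apply/esym/negbTE/negP => /andP[/subsetP SQ _].
    by case/orP: xyS => /SQ; rewrite !inE eqxx ?andbF.
  move/negbT: xyS; rewrite negb_or => /andP[xS yS].
  rewrite !subUset !sub1set xQ yQ /= !inE !eqxx orbT /= !cardsU1 !inE negb_or xny.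
  rewrite xS yS /= !add1n !eqSS.
  have -> : (x |: (y |: S)) :\ x :\ y == S.
    apply/eqP/setP => z; rewrite !inE.
    case: (z =P x) => [->|_]; first by rewrite (negbTE xS) andbF.
    by case: (z =P y) => [->|_] //; rewrite (negbTE yS).
  suff -> : (S \subset Q) = (S \subset Q') by rewrite !andbT.
  apply/idP/idP => /subsetP SQ; apply/subsetP => z zS; last first.
    by move: (SQ z zS); rewrite !inE => /and3P[].
  rewrite !inE (SQ z zS) andbT; apply/andP; split.
    by apply: contraNneq yS => <-.
  by apply: contraNneq xS => <-.
rewrite (eq_bigl _ _ key) (eq_bigl (fun S : {set G} => S \in [set S : {set G} | (S \subset Q') && (#|S| == r)])); last first.
  by move=> S; rewrite inE.
by apply: eq_bigr => S; rewrite inE => /andP[SQ _]; rewrite !inE !eqxx orbT.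
Qed.

End CliqueCone.

(** * Choosing at most two elements of a block *)

Section BlockChoice.

Variables (R : realFieldType) (t : nat) (e : rel 'I_t).
Hypothesis e_sym : symmetric e.
Implicit Types (i j k : 'I_t) (B s : {set 'I_t}).

(** The asymmetry is deliberate: over the two orders of a pair, each of its elements is picked
    exactly once, whether as two singletons (conflict) or as one pair and one empty set (no
    conflict). *)
Definition pick2 i j : {set 'I_t} :=
  if (i == j) || e i j then [set i] else if (i < j)%N then [set i; j] else set0.

(* A probability distribution on the [e]-independent subsets of [B] with at
   most two elements, for [#|B| <= 6]: every element is chosen with probability
   1/6, and every independent pair with probability 1/36, as if the choices of
   the elements of [B] were independent. *)
Definition block_weight B s : R :=
  (\sum_(i in B) \sum_(j in B) (s == pick2 i j)%:R
   + (6 - #|B|%:R) * \sum_(i in B) (s == [set i])%:R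
   + (36 - 6 * #|B|%:R) * (s == set0)%:R) / 36.

Lemma block_weight_ge0 B s : (#|B| <= 6)%N -> 0 <= block_weight B s.
Proof.
move=> B6; have B6R : #|B|%:R <= 6 :> R by rewrite ler_nat.
rewrite divr_ge0 // !addr_ge0 ?mulr_ge0 ?sumr_ge0 //; try lra.
by move=> i _; rewrite sumr_ge0.
Qed.

(** An expectation over two rolls of a fair die with the elements of [B] and [6 - #|B|] blanks as
    faces: two elements give [pick2], an element then a blank gives a singleton, and a blank first
    gives the empty set. *)
Lemma sum_block_weight B (g : {set 'I_t} -> R) :
  \sum_s block_weight B s * g s =
  (\sum_(i in B) \sum_(j in B) g (pick2 i j)
   + (6 - #|B|%:R) * \sum_(i in B) g [set i]
   + (36 - 6 * #|B|%:R) * g set0) / 36.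
Proof.
under eq_bigr do rewrite /block_weight mulrAC.
rewrite -mulr_suml; under eq_bigr do rewrite 2!mulrDl.
rewrite !big_split /=; congr ((_ + _ + _) / _).
- under eq_bigr => s _.
    rewrite mulr_suml; under eq_bigr do rewrite mulr_suml.
    over.
  rewrite exchange_big; apply: eq_bigr => i _.
  by rewrite exchange_big; apply: eq_bigr => j _; rewrite sum_boolM.
- under eq_bigr do rewrite -mulrA mulr_suml.
  rewrite -mulr_sumr exchange_big /=; congr (_ * _).
  by apply: eq_bigr => i _; rewrite sum_boolM.
- by under eq_bigr do rewrite -mulrA; rewrite -mulr_sumr sum_boolM.
Qed.

Lemma block_weight_supp B s : block_weight B s != 0 ->
  s \subset B /\ {in s &, forall i j, i != j -> ~~ e i j}.
Proof.
pose ok := (s \subset B) && [forall i in s, forall j in s, (i != j) ==> ~~ e i j].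
have okP : ok -> s \subset B /\ {in s &, forall i j, i != j -> ~~ e i j}.
  move=> /andP[sB /forall_inP h]; split=> // i j si sj ij.
  by move: (h _ si) => /forall_inP/(_ _ sj)/implyP; apply.
have ok1 i : i \in B -> s = [set i] -> ok.
  move=> iB E; rewrite /ok E sub1set iB /=; apply/forall_inP => a /set1P->.
  by apply/forall_inP => b /set1P->; rewrite eqxx.
have ok0 : s = set0 -> ok.
  by move=> E; rewrite /ok E sub0set; apply/forall_inP => a; rewrite inE.
have ok2 i j : i \in B -> j \in B -> s = pick2 i j -> ok.
  move=> iB jB; rewrite /pick2; case: ifP => [_|/negbT]; first exact: ok1.
  rewrite negb_or => /andP[ij eij]; case: ifP => [_ E|_ /ok0//].
  rewrite /ok E subUset !sub1set iB jB /=.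
  apply/forall_inP => a aij; apply/forall_inP => b bij.
  move: aij bij; rewrite !inE.
  by move=> /orP[]/eqP-> /orP[]/eqP->; rewrite ?eqxx // ?eij ?implybT // e_sym eij implybT.
case nok: ok => bw; first exact: okP; move: bw.
have no (P : bool) : (P -> ok) -> P = false by case: P => // /(_ isT); rewrite nok.
rewrite /block_weight (no _ (fun h => ok0 (eqP h))) mulr0 addr0.
rewrite [X in _ + _ * X]big1 ?mulr0 ?addr0 => [|i iB]; last first.
  by rewrite (no _ (fun h => ok1 i iB (eqP h))).
rewrite big1 ?mul0r ?eqxx // => i iB; rewrite big1 // => j jB.
by rewrite (no _ (fun h => ok2 i j iB jB (eqP h))).
Qed.

Lemma sum_block_weight1 B : \sum_s block_weight B s = 1.
Proof.
under eq_bigr do rewrite -[block_weight _ _]mulr1.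
rewrite (sum_block_weight B (fun=> 1)) !sumr_const -mulrnA natrM.
by field.
Qed.

Lemma pick2_swap i j : i != j ->
  ((i \in pick2 i j) + (i \in pick2 j i) = 1)%N.
Proof.
move=> ij; rewrite /pick2 [j == i]eq_sym (negbTE ij) /= [e j i]e_sym.
case: (e i j); first by rewrite !inE eqxx (negbTE ij).
case: ltngtP => [||/val_inj E]; rewrite ?inE ?eqxx ?orbT //.
by rewrite E eqxx in ij.
Qed.

Lemma mem_pick2 i a b : i \in pick2 a b -> (i == a) || (i == b).
Proof.
rewrite /pick2; case: ifP => _; first by rewrite inE => ->.
by case: ifP => _; rewrite !inE.
Qed.

(** Of the 36 rolls, [#|B|] pairs of elements pick [i] (one on the diagonal, one for each other
    element by [pick2_swap]), and [6 - #|B|] rolls with a blank do: 6 in all. *)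
Lemma sum_block_weight_mem B i : i \in B ->
  \sum_s block_weight B s * (i \in s)%:R = 6^-1.
Proof.
move=> iB; rewrite (sum_block_weight B (fun s => (i \in s)%:R)).
have -> : \sum_(a in B) (i \in [set a])%:R = 1 :> R.
  rewrite (bigD1 i) //= inE eqxx big1 ?addr0 // => a /andP[_ ai].
  by rewrite inE eq_sym (negbTE ai).
have -> : \sum_(a in B) \sum_(b in B) (i \in pick2 a b)%:R = #|B|%:R :> R.
  rewrite (big_setD1 i) //= (big_setD1 i) //=.
  have Sz (a : 'I_t) : a != i ->
      \sum_(b in B) (i \in pick2 a b)%:R = (i \in pick2 a i)%:R :> R.
    move=> ai; rewrite (bigD1 i) //= big1 ?addr0 // => b /andP[_ bi].
    case H: (i \in _) => //; move: (mem_pick2 H).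
    by rewrite ![i == _]eq_sym (negbTE ai) (negbTE bi).
  rewrite [X in _ + X](eq_bigr (fun a => (i \in pick2 a i)%:R)) => [|a]; last first.
    by rewrite !inE => /andP[ai _]; apply: Sz.
  rewrite -addrA -big_split /=.
  rewrite (eq_bigr (fun=> 1)) => [|a].
    rewrite sumr_const (cardsD1 i B) iB add1n -[in RHS]natr1 addrC.
    by rewrite {1}/pick2 eqxx inE eqxx.
  rewrite !inE => /andP[ai _]; rewrite -natrD pick2_swap //.
  by rewrite eq_sym.
by rewrite inE mulr0 mulr1; field.
Qed.

(** Exactly one of the 36 rolls, the pair in increasing order, picks both. *)
Lemma sum_block_weight_mem2 B i j : i \in B -> j \in B -> i != j -> ~~ e i j ->
  \sum_s block_weight B s * ((i \in s) && (j \in s))%:R = 36^-1.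
Proof.
wlog ltij : i j / (i < j)%N.
  move=> hw iB jB ij eij; case: (ltngtP i j) => [lt_ij|ji|/val_inj E]; first exact: hw.
    under eq_bigr do rewrite andbC.
    by apply: hw => //; rewrite 1?eq_sym 1?e_sym.
  by rewrite E eqxx in ij.
move=> iB jB ij eij.
rewrite (sum_block_weight B (fun s => ((i \in s) && (j \in s))%:R)).
have S1 (a : 'I_t) : (i \in [set a]) && (j \in [set a]) = false.
  by apply/negbTE; rewrite !inE; apply: contraNN ij => /andP[/eqP-> /eqP->].
rewrite [X in _ + _ * X + _]big1 ?mulr0 => [|a _]; last by rewrite S1.
rewrite inE mulr0 !addr0.
have P2 (a b : 'I_t) : (i \in pick2 a b) && (j \in pick2 a b) = (a == i) && (b == j).
  rewrite /pick2; case: ifP => [h|/negbT].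
    rewrite S1; apply/esym/negbTE/negP => /andP[/eqP ai /eqP bj].
    by move: h; rewrite ai bj (negbTE ij) (negbTE eij).
  rewrite negb_or => /andP[ab eab]; case: ifP => [lab|/negbT nlab].
    rewrite !inE; apply/idP/idP.
      move=> /andP[/orP[]/eqP ia /orP[]/eqP jb].
      - by rewrite ia jb eqxx in ij.
      - by rewrite ia jb !eqxx.
      - by move: ltij; rewrite ia jb ltnNge ltnW.
      - by rewrite ia jb eqxx in ij.
    by move=> /andP[/eqP-> /eqP->]; rewrite !eqxx orbT.
  rewrite !inE; apply/esym/negbTE/negP => /andP[/eqP ai /eqP bj].
  by rewrite ai bj ltij in nlab.
rewrite (bigD1 i) //= [X in _ + X]big1 => [|a /andP[_ /negbTE ai]]; last first.
  by rewrite big1 // => b _; rewrite P2 ai.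
rewrite addr0 (bigD1 j) //= big1 => [|a /andP[_ /negbTE aj]]; last first.
  by rewrite P2 aj andbF.
by rewrite P2 !eqxx addr0 mul1r.
Qed.

Lemma sum_block_weight_exp B : (#|B| <= 6)%N ->
  \sum_s block_weight B s * 2^-1 ^+ #|s| <= (71 / 72) ^+ #|B|.
Proof.
move=> B6; have B6R : #|B|%:R <= 6 :> R by rewrite ler_nat.
(* The passage to the power is Bernoulli's inequality. The linear bound uses that diagonal rolls
   give singletons, all other pairs being bounded by 1; it is attained by this estimate at
   [#|B| = 6]. *)
apply: (@le_trans _ _ (1 - #|B|%:R / 72)); last first.
  elim: #|B| => [|b IH]; first by rewrite expr0 mul0r subr0.
  rewrite exprS; apply: (@le_trans _ _ (71 / 72 * (1 - b%:R / 72))).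
    by rewrite -natr1; have : 0 <= b%:R :> R by []; lra.
  by rewrite ler_pM2l //; lra.
rewrite (sum_block_weight B (fun s => 2^-1 ^+ #|s|)) cards0 expr0 mulr1.
have g1 (s : {set 'I_t}) : 2^-1 ^+ #|s| <= 1 :> R.
  by rewrite exprn_ile1 //; lra.
have -> : \sum_(i in B) 2^-1 ^+ #|[set i]| = #|B|%:R / 2 :> R.
  by under eq_bigr do rewrite cards1 expr1; rewrite sumr_const mulr_natl.
suff : \sum_(i in B) \sum_(j in B) 2^-1 ^+ #|pick2 i j| <=
    #|B|%:R * (#|B|%:R - 2^-1) :> R.
  by move: B6R; have := ler0n R #|B|; nra.
rewrite mulr_natl -sumr_const; apply: ler_sum => i iB.
have -> : #|B|%:R - 2^-1 = 2^-1 + #|B :\ i|%:R :> R.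
  by rewrite (cardsD1 i B) iB add1n -[#|_|.+1]addn1 natrD; lra.
rewrite (big_setD1 i) //= {1}/pick2 eqxx cards1 expr1 lerD2l.
by rewrite -sum1_card natr_sum; apply: ler_sum.
Qed.

End BlockChoice.

(** * Random independent sets *)

Section IndependentChoice.

Variables (R : realFieldType) (t : nat) (e : rel 'I_t).
Hypothesis e_sym : symmetric e.
Implicit Types (i j k : 'I_t) (phi : {ffun 'I_t -> {set 'I_t}}).

Let e_conn : connect_sym e := sym_connect_sym e_sym.

Local Notation root := (fingraph.root e).

Definition component i := [set j | connect e i j].

Definition small_components := [set i | (#|component i| <= 6)%N].

(** Blocks are empty at non-roots and at roots of large components, so that the choices form a
    product over all indices. *)
Definition block k :=
  if (root k == k) && (k \in small_components) then component k else set0.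

(* [phi] lists the sets chosen in the blocks, indexed by their roots. *)
Definition choice_weight phi : R := \prod_k block_weight R e (block k) (phi k).

Definition chosen phi := \bigcup_k phi k.

Lemma component_eq i j : connect e i j -> component i = component j.
Proof.
by move=> ij; apply/setP => k; rewrite !inE (same_connect e_conn ij).
Qed.

Lemma mem_block i k : (i \in block k) = (root i == k) && (i \in small_components).
Proof.
apply/idP/idP.
  rewrite /block; case: ifP; last by move=> _; rewrite in_set0.
  move=> /andP[/eqP rk sk]; rewrite inE => ki.
  rewrite -(fingraph.rootP e_conn ki) rk eqxx /= inE -(component_eq ki).
  by rewrite inE in sk.
move=> /andP[/eqP<- si]; have ir := connect_root e i.
rewrite /block root_root // eqxx /= inE -(component_eq ir).
by move: (si); rewrite inE => ->; rewrite inE connect0.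
Qed.

Lemma card_block k : (#|block k| <= 6)%N.
Proof.
by rewrite /block; case: ifP => [/andP[_]|_]; rewrite ?cards0 // inE.
Qed.

Lemma choice_weight_ge0 phi : 0 <= choice_weight phi.
Proof. by apply: prodr_ge0 => k _; apply/block_weight_ge0/card_block. Qed.

(** Independence of the blocks: expectations of products factor. *)
Lemma sum_choice_weight (g : 'I_t -> {set 'I_t} -> R) :
  \sum_phi choice_weight phi * \prod_k g k (phi k) =
  \prod_k \sum_s block_weight R e (block k) s * g k s.
Proof.
by rewrite bigA_distr_bigA; apply: eq_bigr => phi _; rewrite -big_split.
Qed.

Section Support.

Variable phi : {ffun 'I_t -> {set 'I_t}}.
Hypothesis phi_supp : choice_weight phi != 0.

Let bw_neq0 k : block_weight R e (block k) (phi k) != 0.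
Proof. by move/prodf_neq0: phi_supp; apply. Qed.

Let phi_block i k : i \in phi k -> (root i == k) && (i \in small_components).
Proof.
have /subsetP sub := proj1 (block_weight_supp e_sym (bw_neq0 k)).
by move=> /sub; rewrite mem_block.
Qed.

Lemma mem_chosen i : (i \in chosen phi) = (i \in phi (root i)).
Proof.
apply/bigcupP/idP => [[k _ ik]|ir]; last by exists (root i).
by have /andP[/eqP->] := phi_block ik.
Qed.

Lemma chosen_small i : i \in chosen phi -> i \in small_components.
Proof. by rewrite mem_chosen => /phi_block/andP[]. Qed.

Lemma chosen_indep : {in chosen phi &, forall i j, i != j -> ~~ e i j}.
Proof.
move=> i j; rewrite !mem_chosen => ir jr ij; apply/negP => eij.
have rij : root i = root j by apply/(fingraph.rootP e_conn)/connect1.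
rewrite rij in ir.
by have /(_ _ _ _ ir jr ij)/negP := fun k => proj2 (block_weight_supp e_sym (bw_neq0 k)).
Qed.

Lemma card_chosen : #|chosen phi| = (\sum_k #|phi k|)%N.
Proof.
rewrite -sum1_card partition_disjoint_bigcup /=.
  by apply: eq_bigr => k _; rewrite sum1_card.
move=> k l kl; apply/pred0P => i /=; apply/negP => /andP[].
move=> /phi_block/andP[/eqP ik _] /phi_block/andP[/eqP il _].
by rewrite -ik -il eqxx in kl.
Qed.

End Support.

Lemma sum_card_block : (\sum_k #|block k|)%N = #|small_components|.
Proof.
have -> : small_components = \bigcup_k block k.
  apply/setP => i; apply/idP/bigcupP => [si|[k _]]; last by rewrite mem_block => /andP[].
  by exists (root i) => //; rewrite mem_block eqxx.
rewrite -[RHS]sum1_card partition_disjoint_bigcup /=.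
  by apply: eq_bigr => k _; rewrite sum1_card.
move=> k l kl; apply/pred0P => i /=; apply/negP => /andP[].
rewrite !mem_block => /andP[/eqP ik _] /andP[/eqP il _].
by rewrite -ik -il eqxx in kl.
Qed.

(** Within one block this is the pair probability; across two blocks it is the product of two
    probabilities 1/6. The block distribution was designed to make these agree. *)
Lemma sum_choice_weight_mem2 i j : i != j -> ~~ e i j ->
  i \in small_components -> j \in small_components ->
  \sum_phi choice_weight phi * ((i \in chosen phi) && (j \in chosen phi))%:R = 36^-1.
Proof.
move=> ij eij si sj.
have ib : i \in block (root i) by rewrite mem_block eqxx.
have jb : j \in block (root j) by rewrite mem_block eqxx.
have [rij|rij] := eqVneq (root i) (root j).
  pose g k (s : {set 'I_t}) : R :=
    if k == root i then ((i \in s) && (j \in s))%:R else 1.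
  transitivity (\sum_phi choice_weight phi * \prod_k g k (phi k)).
    apply: eq_bigr => phi _.
    have [->|w0] := eqVneq (choice_weight phi) 0; first by rewrite !mul0r.
    rewrite !mem_chosen // (bigD1 (root i)) //= big1 ?mulr1.
      by rewrite /g eqxx rij.
    by move=> k /negbTE kr; rewrite /g kr.
  rewrite sum_choice_weight (bigD1 (root i)) //= [X in _ * X]big1 ?mulr1.
    under eq_bigr do rewrite /g eqxx.
    by rewrite sum_block_weight_mem2 // rij.
  move=> k /negbTE kr; under eq_bigr do rewrite /g kr mulr1.
  exact: sum_block_weight1.
pose g k (s : {set 'I_t}) : R :=
  if k == root i then (i \in s)%:R else if k == root j then (j \in s)%:R else 1.
have rji : root j == root i = false by rewrite eq_sym (negbTE rij).
transitivity (\sum_phi choice_weight phi * \prod_k g k (phi k)).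
  apply: eq_bigr => phi _.
  have [->|w0] := eqVneq (choice_weight phi) 0; first by rewrite !mul0r.
  rewrite !mem_chosen // (bigD1 (root i)) //= (bigD1 (root j)) /=; last by rewrite rji.
  rewrite big1 ?mulr1; first by rewrite /g !eqxx rji -natrM mulnb.
  by move=> k /andP[/negbTE ki /negbTE kj]; rewrite /g ki kj.
rewrite sum_choice_weight (bigD1 (root i)) //= (bigD1 (root j)) /=; last by rewrite rji.
rewrite [X in _ * (_ * X)]big1 ?mulr1.
  under eq_bigr do rewrite /g eqxx.
  under [X in _ * X]eq_bigr do rewrite /g rji eqxx.
  by rewrite !sum_block_weight_mem // -invfM -natrM.
move=> k /andP[/negbTE ki /negbTE kj]; under eq_bigr do rewrite /g ki kj mulr1.
exact: sum_block_weight1.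
Qed.

(** Exponential Markov inequality: the indicator is at most [2 ^+ m * 2^-1 ^+ #|chosen phi|], whose
    expectation factors over the blocks. *)
Lemma sum_choice_weight_few m :
  \sum_phi choice_weight phi * (#|chosen phi| < m)%:R
    <= 2 ^+ m * (71 / 72) ^+ #|small_components|.
Proof.
apply: (@le_trans _ _ (2 ^+ m * (\sum_phi choice_weight phi *
    \prod_k 2^-1 ^+ #|phi k|))).
  rewrite mulr_sumr; apply: ler_sum => phi _.
  have [->|w0] := eqVneq (choice_weight phi) 0; first by rewrite !mul0r mulr0.
  rewrite mulrCA ler_wpM2l ?choice_weight_ge0 // prodrXr -card_chosen //.
  rewrite exprVn; case: ltnP => [cm|_]; last by rewrite divr_ge0 // exprn_ge0.
  by rewrite ler_pdivlMr ?exprn_gt0 // mul1r ler_eXn2l ?ltr1n // ltnW.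
rewrite ler_pM2l ?exprn_gt0 // (sum_choice_weight (fun _ s => 2^-1 ^+ #|s|)) -sum_card_block -prodrXr.
apply: ler_prod => k _; rewrite sum_block_weight_exp ?card_block // andbT.
apply: sumr_ge0 => s _; rewrite mulr_ge0 ?block_weight_ge0 ?card_block //.
by rewrite exprn_ge0 // invr_ge0.
Qed.

Definition pair_weight m i j : R := \sum_phi choice_weight phi *
  [&& (m <= #|chosen phi|)%N, i \in chosen phi & j \in chosen phi]%:R.

Lemma pair_weight_ge0 m i j : 0 <= pair_weight m i j.
Proof. by apply: sumr_ge0 => phi _; rewrite mulr_ge0 ?choice_weight_ge0. Qed.

Lemma pair_weight_le m i j : i != j -> pair_weight m i j <= 36^-1.
Proof.
move=> ij; have [nok|] := boolP
    [|| e i j, i \notin small_components | j \notin small_components].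
  (* Conflicting indices and indices in large components are never chosen together, so the weight is
     0. *)
  rewrite [leLHS]big1 ?invr_ge0 // => phi _.
  have [->|w0] := eqVneq (choice_weight phi) 0; first by rewrite mul0r.
  case c: [&& _, _ & _]; last by rewrite mulr0.
  have /and3P[_ ic jc] := c; move: nok.
  by rewrite (negbTE (chosen_indep w0 ic jc ij)) !(chosen_small w0).
rewrite !negb_or !negbK => /and3P[eij si sj].
rewrite -(sum_choice_weight_mem2 ij eij si sj); apply: ler_sum => phi _.
by rewrite ler_wpM2l ?choice_weight_ge0 // ler_nat; case: (m <= _)%N.
Qed.

Lemma pair_weight_ge m i j : i != j -> ~~ e i j ->
  i \in small_components -> j \in small_components ->
  36^-1 - 2 ^+ m * (71 / 72) ^+ #|small_components| <= pair_weight m i j.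
Proof.
move=> ij eij si sj; rewrite lerBlDr.
apply: le_trans (lerD (lexx _) (sum_choice_weight_few m)).
rewrite -(sum_choice_weight_mem2 ij eij si sj) -big_split /=.
apply: ler_sum => phi _; rewrite -mulrDr ler_wpM2l ?choice_weight_ge0 //.
by rewrite -natrD ler_nat; case: ltnP => _; rewrite ?addn0 ?leq_addl //= leq_b1.
Qed.

End IndependentChoice.

(** * Random sequences of vertices *)

Section RandomVertices.

Variables (R : realFieldType) (G : sgraph) (t : nat).
Implicit Types (i j k l : 'I_t) (v w : {ffun 'I_t -> G}) (A : {set 'I_t}).
Implicit Types (h : {ffun 'I_t -> G} -> R).

(* Indices carrying the same vertex are in conflict as well. *)
Definition conflict v : rel 'I_t := fun i j => ~~ adj (v i) (v j).

Lemma conflict_sym v : symmetric (conflict v).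
Proof. by move=> i j; rewrite /conflict adj_sym. Qed.

Definition update v j (u : G) : {ffun 'I_t -> G} :=
  [ffun k => if k == j then u else v k].

(** Resampling one coordinate preserves the uniform measure: swapping [v j] with the fresh vertex
    [u] is an involution. *)
Lemma sum_update h j :
  \sum_v \sum_u h (update v j u) = #|G|%:R * \sum_v h v.
Proof.
pose f (p : {ffun 'I_t -> G} * G) := (update p.1 j p.2, p.1 j).
have fK : involutive f.
  move=> [v u]; rewrite /f /= ffunE eqxx; congr (_, _).
  by apply/ffunP => k; rewrite !ffunE; case: eqP => // ->.
rewrite pair_big /=.
transitivity (\sum_(p : {ffun 'I_t -> G} * G) h p.1).
  by rewrite [RHS](reindex_inj (inv_inj fK)).
rewrite -(pair_big xpredT xpredT (fun v (u : G) => h v)) /= mulr_sumr.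
by apply: eq_bigr => v _; rewrite sumr_const mulr_natl.
Qed.

Definition depends_on A h := forall v w, {in A, v =1 w} -> h v = h w.

Lemma depends_on_update A h v j u : depends_on A h -> j \notin A ->
  h (update v j u) = h v.
Proof.
move=> hA jA; apply: hA => k kA; rewrite ffunE; case: eqP => // kj.
by rewrite -kj kA in jA.
Qed.

Variable eps : R.
Hypothesis G_gt0 : (0 < #|G|)%N.
Hypothesis nonadj : forall x : G, #|[set u | ~~ adj x u]|%:R <= eps * #|G|%:R.

Let eps_ge0 : 0 <= eps.
Proof.
have /card_gt0P[x _] := G_gt0.
have := le_trans (ler0n R _) (nonadj x).
by rewrite pmulr_lge0 // ltr0n.
Qed.

(** Resample coordinate [j]: neither [h] nor [v p] changes, and at most a fraction [eps] of the
    fresh vertices conflicts with [v p]. *)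
Lemma sum_conflict A h p j : (forall v, 0 <= h v) -> depends_on A h ->
  p \in A -> j \notin A ->
  \sum_v h v * (conflict v p j)%:R <= eps * \sum_v h v.
Proof.
move=> h0 hA pA jA; have G0 : 0 < #|G|%:R :> R by rewrite ltr0n.
rewrite -(ler_pM2l G0) -(sum_update _ j) mulrA (mulrC _ eps) mulr_sumr.
apply: ler_sum => v _.
have pj : p == j = false by apply: contraNF jA => /eqP <-.
under eq_bigr do rewrite (depends_on_update v _ hA) // /conflict !ffunE eqxx pj.
rewrite -mulr_sumr [leLHS]mulrC ler_wpM2r //; apply: le_trans (nonadj (v p)).
rewrite -sum1_card natr_sum [leRHS]big_mkcond /=; apply: ler_sum => u _.
by rewrite inE; case: adj.
Qed.

(* For [#|A| + m <= 7] this dominates the indicator that [A] meets a component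
   with at least 7 elements: a union bound over the ways of leaving [A] [m]
   times in a row along conflicts. *)
Fixpoint explorations m A v : R :=
  if m is m'.+1 then
    \sum_(j | j \notin A) \sum_(p in A)
      (conflict v p j)%:R * explorations m' (j |: A) v
  else 1.

Lemma explorations_ge0 m A v : 0 <= explorations m A v.
Proof.
elim: m A => [|m IH] A //=; apply: sumr_ge0 => j _; apply: sumr_ge0 => p _.
by rewrite mulr_ge0.
Qed.

(** Each step costs a factor [eps] for the conflict, at most [t] choices of [j] and at most 6 of
    [p]. The induction absorbs the conflict indicator into [h], which then depends on [j |: A]. *)
Lemma sum_explorations m A h : (#|A| + m <= 7)%N -> (forall v, 0 <= h v) ->
  depends_on A h ->
  \sum_v h v * explorations m A v <= (6 * t%:R * eps) ^+ m * \sum_v h v.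
Proof.
elim: m A h => [|m IH] A h Am h0 hA /=.
  by rewrite expr0 mul1r; under eq_bigr do rewrite mulr1.
have A6 : (#|A| <= 6)%N by lia.
under eq_bigr do rewrite mulr_sumr.
rewrite exchange_big /=.
pose c := (6 * t%:R * eps) ^+ m * (eps * \sum_v h v).
have c0 : 0 <= c by rewrite !mulr_ge0 ?exprn_ge0 ?mulr_ge0 ?sumr_ge0.
apply: (@le_trans _ _ (\sum_(j | j \notin A) \sum_(p in A) c)).
  apply: ler_sum => j jA; under eq_bigr do rewrite mulr_sumr.
  rewrite exchange_big; apply: ler_sum => p pA /=.
  under eq_bigr do rewrite mulrA.
  apply: le_trans (IH _ _ _ _ _) _.
  - by rewrite cardsU1 jA add1n addSnnS.
  - by move=> v; rewrite mulr_ge0.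
  - move=> v w vw; rewrite (hA v w) => [|k kA]; last by rewrite vw // inE kA orbT.
    by rewrite /conflict !vw // !inE ?eqxx ?pA ?orbT.
  by rewrite ler_wpM2l ?exprn_ge0 ?mulr_ge0 // (sum_conflict h0 hA).
rewrite !sumr_const -mulrnA -[leLHS]mulr_natr exprS /c.
have -> : 6 * t%:R * eps * (6 * t%:R * eps) ^+ m * (\sum_v h v) =
    c * (6 * t%:R) by rewrite /c; ring.
rewrite -/c ler_wpM2l // -natrM ler_nat leq_mul //.
by rewrite -[leqRHS]card_ord max_card.
Qed.

(** While steps remain, [A] has at most 6 elements and cannot contain the component of [l]; hence
    some conflict leaves [A], and following it gives a term at least 1. *)
Lemma explorations_ge1 m A v l : l \in A -> l \notin small_components (conflict v) ->
  (#|A| + m <= 7)%N -> 1 <= explorations m A v.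
Proof.
move=> + lbig; elim: m A => [|m IH] A lA Am //=.
have /exists_inP[p pA /existsP[j /andP[jA pj]]] :
    [exists p in A, [exists j, (j \notin A) && conflict v p j]].
  apply: contraNT lbig => /exists_inPn nop.
  have clA : closed (conflict v) (mem A).
    apply: intro_closed; first exact/sym_connect_sym/conflict_sym.
    move=> a b ab aA; apply: contraNT (nop a aA) => bA.
    by apply/existsP; exists b; rewrite bA.
  rewrite inE; apply: (@leq_trans #|A|); last by lia.
  apply/subset_leq_card/subsetP => k; rewrite inE => lk.
  by rewrite -(closed_connect clA lk).
rewrite (bigD1 j) //= (bigD1 p) //= pj mul1r -addrA.
rewrite ler_wpDr ?IH //; last first.
- by rewrite cardsU1 jA add1n addSnnS.
- by rewrite inE lA orbT.
rewrite addr_ge0 // ?sumr_ge0 // => [a _|a _].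
  by rewrite mulr_ge0 // explorations_ge0.
by apply: sumr_ge0 => b _; rewrite mulr_ge0 // explorations_ge0.
Qed.

Lemma sum_not_small A h l : (#|A| <= 2)%N -> (forall v, 0 <= h v) ->
  depends_on A h ->
  \sum_v h v * (l \notin small_components (conflict v))%:R
    <= (6 * t%:R * eps) ^+ 4 * \sum_v h v.
Proof.
(* Starting from [l |: A], with at most three elements, leaves room for four steps. *)
move=> A2 h0 hA; have cA : (#|l |: A| + 4 <= 7)%N by rewrite cardsU1 -addnA (@leq_add _ _ 1 6) ?leq_b1 // (@leq_add _ _ 2 4).
apply: le_trans (sum_explorations cA h0 _) => [|v w vw]; last first.
  by apply: hA => k kA; rewrite vw // inE kA orbT.
apply: ler_sum => v _; rewrite ler_wpM2l //.
case: (boolP (l \in _)) => [_|lb]; first by rewrite mulr0n explorations_ge0.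
by apply: explorations_ge1 lb cA; rewrite setU11.
Qed.

(** * Two indices pinned to a given pair of vertices *)

Section PinnedPair.

Variables (i j : 'I_t) (x y : G).
Hypothesis ij : i != j.

Definition pinned v : R := ((v i == x) && (v j == y))%:R.

Lemma sum_pinned : #|G|%:R ^+ 2 * \sum_v pinned v = #|G|%:R ^+ t.
Proof.
have s1 k (z : G) : #|G|%:R * \sum_(v : {ffun 'I_t -> G}) (v k == z)%:R = #|G|%:R ^+ t :> R.
  rewrite -(sum_update _ k) (eq_bigr (fun=> 1)) => [|v _].
    by rewrite sumr_const card_ffun card_ord natrX.
  rewrite (eq_bigr (fun u => (u == z)%:R * 1)) => [|u _]; last first.
    by rewrite ffunE eqxx mulr1.
  by rewrite (sum_boolM z (fun=> 1)).
rewrite expr2 -mulrA -(sum_update _ j) -(s1 i x); congr (_ * _).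
apply: eq_bigr => v _; rewrite -[RHS](sum_boolM y (fun=> (v i == x)%:R)).
apply: eq_bigr => u _; rewrite /pinned !ffunE eqxx (negbTE ij).
by rewrite andbC -natrM mulnb.
Qed.

Lemma pinned_ge0 v : 0 <= pinned v. Proof. exact: ler0n. Qed.

Lemma depends_on_pinned : depends_on [set i; j] pinned.
Proof. by move=> v w vw; rewrite /pinned !vw // !inE eqxx ?orbT. Qed.

Lemma sum_pinned_pair_weight_le m :
  \sum_v pinned v * pair_weight R (conflict v) m i j <= 36^-1 * \sum_v pinned v.
Proof.
rewrite mulr_sumr; apply: ler_sum => v _.
rewrite mulrC ler_wpM2r ?pinned_ge0 // pair_weight_le //.
exact: conflict_sym.
Qed.

Lemma sum_pinned_pair_weight_ge m s : adj x y -> (0 < s)%N -> t = (s * 2)%N ->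
  (36^-1 * (1 - 4 * (6 * t%:R * eps) ^+ 4) - 2 ^+ m * (71 / 72) ^+ s)
    * \sum_v pinned v <= \sum_v pinned v * pair_weight R (conflict v) m i j.
Proof.
move=> xy s0 ts.
pose bad l v : R := (l \notin small_components (conflict v))%:R.
have s0R : 0 < s%:R :> R by rewrite ltr0n.
(* If fewer than [s] of the [2 * s] indices are small, the last sum over [bad] divided by [s] is at
   least 1. So any failure makes [low] nonpositive; otherwise [pair_weight_ge] applies. *)
pose low v := 36^-1 * (1 - bad i v - bad j v - s%:R^-1 * \sum_l bad l v)
                - 2 ^+ m * (71 / 72) ^+ s.
have low_le v : pinned v * low v <= pinned v * pair_weight R (conflict v) m i j.
  rewrite /pinned; case: andP => [[/eqP vi /eqP vj]|_]; last by rewrite !mul0r.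
  rewrite !mul1r; have e_sym := @conflict_sym v.
  have bad0 l : 0 <= bad l v by [].
  have sb0 : 0 <= s%:R^-1 * \sum_l bad l v by rewrite mulr_ge0 ?invr_ge0 ?sumr_ge0.
  have pw0 := pair_weight_ge0 R (conflict v) m i j.
  have c0 : 0 <= 2 ^+ m * (71 / 72) ^+ s :> R.
    by rewrite mulr_ge0 ?exprn_ge0 //; lra.
  rewrite /low; have [si|bi] := boolP (i \in small_components (conflict v)); last first.
    by have b1 : bad i v = 1; [rewrite /bad bi|have := bad0 j; lra].
  have [sj|bj] := boolP (j \in small_components (conflict v)); last first.
    by have b1 : bad j v = 1; [rewrite /bad bj|have := bad0 i; lra].
  have [small|few] := leqP s #|small_components (conflict v)|; last first.
    have : 1 <= s%:R^-1 * \sum_l bad l v.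
      rewrite mulrC ler_pdivlMr // mul1r /bad -natr_sum ler_nat.
      rewrite (eq_bigr (fun l => if l \in ~: small_components (conflict v) then 1 else 0)%N).
        rewrite -big_mkcond sum1_card.
        have cS : (#|small_components (conflict v)| +
            #|~: small_components (conflict v)|)%N = (s * 2)%N.
          by rewrite cardsC card_ord.
        by move: few cS; move: #|_| #|_| => a b; lia.
      by move=> l _; rewrite in_setC; case: (l \in _).
    by have := bad0 i; have := bad0 j; lra.
  have cf : ~~ conflict v i j by rewrite /conflict vi vj xy.
  have := pair_weight_ge R e_sym m ij cf si sj.
  suff : (71 / 72) ^+ #|small_components (conflict v)| <= (71 / 72) ^+ s :> R.
    rewrite -(ler_pM2l (_ : 0 < 2 ^+ m)) ?exprn_gt0 //.
    by have := bad0 i; have := bad0 j; lra.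
  by rewrite ler_wiXn2l //; lra.
apply: le_trans (ler_sum _ (fun v _ => low_le v)).
pose N := \sum_v pinned v; rewrite -/N.
pose b := (6 * t%:R * eps) ^+ 4.
have badN l : \sum_v pinned v * bad l v <= b * N.
  apply: (@sum_not_small [set i; j]); rewrite ?cards2 ?ij //.
  exact: depends_on_pinned.
have -> : \sum_v pinned v * low v = 36^-1 * (N - \sum_v pinned v * bad i v
    - \sum_v pinned v * bad j v - s%:R^-1 * \sum_l \sum_v pinned v * bad l v)
    - 2 ^+ m * (71 / 72) ^+ s * N.
  rewrite exchange_big /= [X in s%:R^-1 * X](eq_bigr (fun v => pinned v * \sum_l bad l v)).
    rewrite /N !(mulr_sumr, =^~ sumrB); apply: eq_bigr => v _; rewrite /low.
    ring.
  by move=> v _; rewrite mulr_sumr.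
(* With [t = 2 * s] this costs [2 * b]; together with [bad i] and [bad j] it gives the factor 4 in
   the statement. *)
have : s%:R^-1 * \sum_l \sum_v pinned v * bad l v <= 2 * b * N.
  rewrite mulrC ler_pdivrMr //; apply: le_trans (ler_sum _ (fun l _ => badN l)) _.
  rewrite sumr_const card_ord -[leLHS]mulr_natl [in t%:R]ts natrM; lra.
have := badN i; have := badN j; rewrite -/b; lra.
Qed.

End PinnedPair.

End RandomVertices.

(** * The random clique *)

(** Ensures that [2 ^+ r * (71 / 72) ^+ (300 * r)] is at most [32^-1 ^+ r]. Rounding up at the
    powers 5, 25 and 50 keeps the numerals small. *)
Lemma expr71_72_300_le (R : realFieldType) : (71 / 72) ^+ 300 <= 64^-1 :> R.
Proof.
have pow (a b c : R) n : 0 <= a -> a ^+ n <= b -> forall k, b ^+ k <= c ->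
    a ^+ (n * k) <= c.
  move=> a0 ab k bc; apply: le_trans bc.
  by rewrite exprM lerXn2r // nnegrE ?exprn_ge0 // (le_trans _ ab) ?exprn_ge0.
have h5 : (71 / 72) ^+ 5 <= 9325 / 10000 :> R by rewrite !exprS expr0; lra.
have h25 : (71 / 72) ^+ (5 * 5) <= 7052 / 10000 :> R.
  by apply: pow h5 _ _; [lra | rewrite !exprS expr0; lra].
have h50 : (71 / 72) ^+ (5 * 5 * 2) <= 2^-1 :> R.
  by apply: pow h25 _ _; [lra | rewrite !exprS expr0; lra].
have -> : (300 = 5 * 5 * 2 * 6)%N by [].
by apply: pow h50 _ _; [lra | rewrite !exprS expr0; lra].
Qed.

Lemma sqr_le_exp32 r : (3 <= r)%N -> (576 * r ^ 2 <= 32 ^ r)%N.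
Proof.
elim: r => // r IH; rewrite ltnS leq_eqVlt => /orP[/eqP<- //|r3].
by rewrite expnS; have := IH r3; rewrite !expnS expn0; nia.
Qed.

Lemma loss_bound (R : realFieldType) (r : nat) (eps : R) :
  (3 <= r)%N -> eps ^+ 2 * r%:R ^+ 3 * 10 ^+ 8 <= 1 ->
  36^-1 <= (1 + (r%:R * r.+1%:R)^-1) *
    (36^-1 * (1 - 4 * (6 * (600 * r)%:R * eps) ^+ 4)
      - 2 ^+ r.+2 * (71 / 72) ^+ (300 * r)).
Proof.
move=> r3 he; have r3R : 3 <= r%:R :> R by rewrite ler_nat.
have r0R : 0 < r%:R :> R by lra.
set X : R := (r%:R ^+ 2)^-1.
have X0 : 0 < X by rewrite invr_gt0 exprn_gt0.
have X9 : X <= 9^-1.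
  by rewrite lef_pV2 ?posrE ?exprn_gt0 // expr2; nra.
have b1 : (6 * (600 * r)%:R * eps) ^+ 4 <= 17 / 1000 * X.
  have -> : (6 * (600 * r)%:R * eps) ^+ 4 =
      3600 ^+ 4 * (eps ^+ 2 * r%:R ^+ 3) ^+ 2 * X :> R.
    by rewrite natrM /X; field; lra.
  rewrite ler_pM2r //.
  have : (eps ^+ 2 * r%:R ^+ 3 * 10 ^+ 8) ^+ 2 <= 1.
    by rewrite exprn_ile1 // mulr_ge0 ?exprn_ge0 // mulr_ge0 ?sqr_ge0 // exprn_ge0 // ltW.
  by rewrite exprMn; set E := (_ * _) ^+ 2; lra.
have b2 : 2 ^+ r.+2 * (71 / 72) ^+ (300 * r) <= 144^-1 * X.
  apply: (@le_trans _ _ (2 ^+ r.+2 * (64^-1) ^+ r)).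
    rewrite ler_pM2l ?exprn_gt0 // exprM lerXn2r // ?nnegrE ?exprn_ge0 ?expr71_72_300_le //; lra.
  have -> : 2 ^+ r.+2 * 64^-1 ^+ r = 4 * 32^-1 ^+ r :> R.
    rewrite -[r.+2]addn2 exprD mulrAC -exprMn mulrC; congr (_ * _ ^+ _).
      by rewrite expr2; lra.
    by lra.
  rewrite /X exprVn -invfM ler_pdivrMr ?exprn_gt0 // mulrC ler_pdivlMr; last first.
    by rewrite mulr_gt0 ?exprn_gt0.
  have : (576 * r ^ 2)%:R <= (32 ^ r)%:R :> R by rewrite ler_nat sqr_le_exp32.
  rewrite natrM !natrX; lra.
have d1 : 3 / 4 * X <= (r%:R * r.+1%:R)^-1.
  have -> : 3 / 4 * X = (4 / 3 * r%:R ^+ 2)^-1 by rewrite /X; field; lra.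
  rewrite lef_pV2 ?posrE ?mulr_gt0 ?exprn_gt0 //; last lra.
  by rewrite -[r.+1]addn1 natrD; nra.
(* The relative losses are [4 * 17 / 1000 * X] from large components and [36 / 144 * X] from small
   samples, together below [32 / 100 * X]; the gain [3 / 4 * X] outweighs them since [X <= 9^-1]. *)
apply: (@le_trans _ _ ((1 + 3 / 4 * X) * (36^-1 * (1 - 32 / 100 * X)))).
  by have : X * X <= 9^-1 * X; [rewrite ler_pM2r|lra].
move: {b1}(_ ^+ 4) (b1) {b2}(_ * _ ^+ (300 * r)) (b2) {d1}((r%:R * _)^-1) (d1).
by move=> B b1 C b2 D d1; apply: ler_pM; lra.
Qed.

(** * Coverage of the edges by the random clique, and its correction *)

Section MainConstruction.

Variables (R : realFieldType) (G : sgraph) (r : nat) (eps : R).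
Hypothesis r_ge3 : (3 <= r)%N.
Hypothesis G_gt0 : (0 < #|G|)%N.
Hypothesis nonadj : forall x : G, #|[set u | ~~ adj x u]|%:R <= eps * #|G|%:R.
Hypothesis eps_small : eps ^+ 2 * r%:R ^+ 3 * 10 ^+ 8 <= 1.

Local Notation t := (600 * r)%N.
Implicit Types (v : {ffun 'I_t -> G}) (phi : {ffun 'I_t -> {set 'I_t}}).

Let sampled v phi : {set G} := v @: chosen phi.

Let weight v phi : R :=
  choice_weight R (conflict v) phi * (r.+2 <= #|chosen phi|)%N%:R.

Let coverage (x y : G) : R := \sum_v \sum_phi
  weight v phi * ((x \in sampled v phi) && (y \in sampled v phi))%:R.

Let choice_neq0 v phi : weight v phi != 0 -> choice_weight R (conflict v) phi != 0.
Proof. by apply: contraNneq => w0; rewrite /weight w0 mul0r. Qed.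

Let weight_ge0 v phi : 0 <= weight v phi.
Proof. by rewrite mulr_ge0 ?choice_weight_ge0. Qed.

Let sampled_adj v phi : weight v phi != 0 ->
  {in chosen phi &, forall i j, i != j -> adj (v i) (v j)}.
Proof.
move=> /choice_neq0 w0 i j ic jc ij.
by have := chosen_indep (@conflict_sym _ _ v) w0 ic jc ij; rewrite negbK.
Qed.

Let sampled_inj v phi : weight v phi != 0 -> {in chosen phi &, injective v}.
Proof.
move=> w0 i j ic jc vij; apply: contraTeq isT => ij.
by have := sampled_adj w0 ic jc ij; rewrite vij adj_irrefl.
Qed.

Let clique_sampled v phi : weight v phi != 0 -> clique (sampled v phi).
Proof.
move=> w0; apply/cliqueP => _ _ /imsetP[i ic ->] /imsetP[j jc ->] vij.
by apply: (sampled_adj w0) => //; apply: contraNneq vij => ->.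
Qed.

Let card_sampled v phi : weight v phi != 0 -> (r.+2 <= #|sampled v phi|)%N.
Proof.
move=> w0; rewrite /sampled (card_in_imset (sampled_inj w0)).
by move: w0; rewrite /weight; case: leqP => // _; rewrite mulr0 eqxx.
Qed.

Let mem_sampled v phi x : weight v phi != 0 ->
  (x \in sampled v phi)%:R = \sum_i ((v i == x) && (i \in chosen phi))%:R :> R.
Proof.
move=> w0; case: imsetP => [[i ic ->]|nx].
  rewrite (bigD1 i) //= eqxx ic big1 ?addr0 // => j ji.
  case: andP => // -[/eqP vji jc]; move: ji.
  by rewrite (sampled_inj w0 jc ic vji) eqxx.
rewrite big1 // => i _; case: andP => // -[/eqP vi ic].
by case: nx; exists i.
Qed.

(** The vertices at chosen indices are distinct, so membership of [x] in the sample is a sum over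
    the indices carrying [x]; multiplying two such sums gives ordered pairs of indices. *)
Let coverageE x y : x != y -> coverage x y =
  \sum_(i : 'I_t) \sum_(j : 'I_t | j != i)
    \sum_(v : {ffun 'I_t -> G}) pinned R i j x y v * pair_weight R (conflict v) r.+2 i j.
Proof.
move=> xy; under [RHS]eq_bigr do rewrite exchange_big /=.
rewrite [RHS]exchange_big; apply: eq_bigr => v _ /=.
under [RHS]eq_bigr => i _.
  under eq_bigr do rewrite /pair_weight mulr_sumr.
  rewrite exchange_big /=.
  over.
rewrite [RHS]exchange_big; apply: eq_bigr => phi _ /=.
have [w0|w0] := eqVneq (weight v phi) 0.
  rewrite w0 mul0r big1 // => i _; rewrite big1 // => j _.
  move: w0; rewrite /weight; case: (_ <= _)%N; last by rewrite /= !mulr0.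
  by rewrite mulr1 => ->; rewrite mul0r mulr0.
rewrite -mulnb natrM !mem_sampled // mulr_suml mulr_sumr.
apply: eq_bigr => i _; rewrite !mulr_sumr [RHS]big_mkcond /=.
apply: eq_bigr => j _; rewrite /pinned /weight.
have [->|ji] /= := eqVneq j i.
  rewrite -natrM mulnb; case: andP => [[/andP[/eqP vx _] /andP[/eqP vy _]]|_].
    by rewrite -vx -vy eqxx in xy.
  by rewrite mulr0.
case: (v i == x) => /=; last by rewrite !(mulr0, mul0r).
case: (v j == y) => /=; last by rewrite !(mulr0, mul0r).
by rewrite mul1r -natrM mulnb -mulrA -natrM mulnb.
Qed.

Let coverageC x y : coverage x y = coverage y x.
Proof.
apply: eq_bigr => v _; apply: eq_bigr => phi _.
by rewrite andbC.
Qed.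

Let pairs : R := \sum_(i : 'I_t) \sum_(j : 'I_t | j != i) 1.

Let total : R := #|G|%:R ^+ t / #|G|%:R ^+ 2.

Let G0 : 0 < #|G|%:R :> R. Proof. by rewrite ltr0n. Qed.

Let total_gt0 : 0 < total. Proof. by rewrite divr_gt0 ?exprn_gt0. Qed.

Let sum_pinnedE (i j : 'I_t) (x y : G) : i != j ->
  \sum_v pinned R i j x y v = total.
Proof.
move=> ij; rewrite /total -(sum_pinned R x y ij) mulrAC divff ?mul1r //.
by rewrite expf_neq0 // gt_eqF.
Qed.

Let pairs_gt0 : 0 < pairs.
Proof.
have lt0t : (0 < t)%N by clear -r_ge3; lia.
have lt1t : (1 < t)%N by clear -r_ge3; lia.
rewrite /pairs (bigD1 (Ordinal lt0t)) //= (bigD1 (Ordinal lt1t)) //=.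
rewrite ltr_wpDr ?ltr_wpDr ?sumr_ge0 // => i _.
by rewrite sumr_ge0.
Qed.

(** The coverage of an edge if no sample were lost: [total] sequences for each of the [pairs]
    ordered pairs of indices, each with probability 1/36. *)
Let level : R := 36^-1 * total * pairs.

Let level_gt0 : 0 < level.
Proof. by rewrite mulr_gt0 ?pairs_gt0 // mulr_gt0 ?total_gt0 // invr_gt0. Qed.

Let coverage_le x y : x != y -> coverage x y <= level.
Proof.
move=> xy; rewrite coverageE // /level /pairs mulr_sumr; apply: ler_sum => i _.
rewrite mulr_sumr; apply: ler_sum => j ji; rewrite mulr1.
rewrite -(@sum_pinnedE i j x y) 1?eq_sym //.
by apply: sum_pinned_pair_weight_le; rewrite eq_sym.
Qed.

Let coverage_ge x y : adj x y -> level <= (1 + (r%:R * r.+1%:R)^-1) * coverage x y.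
Proof.
move=> xy; have xny : x != y by apply: contraTneq xy => ->; rewrite adj_irrefl.
rewrite coverageE // /level /pairs !mulr_sumr; apply: ler_sum => i _.
rewrite !mulr_sumr; apply: ler_sum => j ji; rewrite mulr1.
have ij : i != j by rewrite eq_sym.
have s0 : (0 < 300 * r)%N by clear -r_ge3; lia.
have ts : t = (300 * r * 2)%N by clear -r_ge3; lia.
have := sum_pinned_pair_weight_ge G_gt0 nonadj ij r.+2 xy s0 ts.
have d0 : 0 <= 1 + (r%:R * r.+1%:R)^-1 :> R.
  by rewrite addr_ge0 // invr_ge0 mulr_ge0.
move=> /(ler_wpM2l d0); apply: le_trans.
rewrite (sum_pinnedE _ _ ij) [leRHS]mulrA ler_pM2r //.
exact: loss_bound.
Qed.

Lemma clique_cone1 : @clique_cone R G r (fun _ _ => 1).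
Proof.
(* The correction factor: [coverage_le] and [coverage_ge] place it in the interval handled by
   [clique_cone_clique], and averaging the corrected cliques gives every edge the weight [level]. *)
pose f x y := level / coverage x y.
have cov_gt0 x y : adj x y -> 0 < coverage x y.
  move=> xy; have := lt_le_trans level_gt0 (coverage_ge xy).
  by rewrite pmulr_rgt0 // ltr_wpDr // invr_ge0 mulr_ge0.
have := @clique_cone_sum R G r _ (index_enum _) xpredT
  (fun v x y => \sum_phi weight v phi *
    (((x \in sampled v phi) && (y \in sampled v phi))%:R * f x y)).
move=> /(_ _)/(clique_coneZ (_ : 0 <= level^-1)) => H.
apply: eq_clique_cone (H _ _) => [x y xy| |v _].
- have -> : \sum_v \sum_phi weight v phi *
      (((x \in sampled v phi) && (y \in sampled v phi))%:R * f x y) =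
      coverage x y * f x y.
    rewrite mulr_suml; apply: eq_bigr => v _; rewrite mulr_suml.
    by apply: eq_bigr => phi _; rewrite mulrA.
  rewrite /f; field.
  by rewrite !gt_eqF ?cov_gt0.
- by rewrite invr_ge0 ltW.
apply: clique_cone_sum => phi _.
have [w0|w0] := eqVneq (weight v phi) 0.
  by apply: eq_clique_cone (clique_cone0 R G r) => x y _; rewrite w0 mul0r.
apply: clique_coneZ => //; apply: clique_cone_clique.
- exact: ltnW.
- exact: clique_sampled.
- exact: card_sampled.
- by move=> x y; rewrite /f coverageC.
move=> x y xy; have xny : x != y by apply: contraTneq xy => ->; rewrite adj_irrefl.
have c0 := cov_gt0 _ _ xy.
by rewrite ler_pdivlMr // mul1r coverage_le // ler_pdivrMr // coverage_ge.
Qed.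

End MainConstruction.

(** * Copies of complete graphs *)

Section Copies.

Variables (G : sgraph) (r : nat).
Implicit Types (S : {set G}) (H : {set G} * {set {set G}}).

Definition clique_copy S : {set G} * {set {set G}} :=
  (S, [set [set p.1; p.2] | p : G * G & [&& p.1 \in S, p.2 \in S & p.1 != p.2]]).

Lemma edgeP (e : {set G}) :
  reflect (exists x y, adj x y /\ e = [set x; y]) (e \in edges G).
Proof.
apply: (iffP imsetP) => [[[x y]]|[x [y [xy ->]]]]; rewrite ?inE /=.
  by move=> xy ->; exists x, y.
by exists (x, y); rewrite ?inE.
Qed.

Lemma mem_clique_copy S x y : x != y ->
  ([set x; y] \in (clique_copy S).2) = (x \in S) && (y \in S).
Proof.
move=> xy; apply/imsetP/idP => [[[a b]]|/andP[xS yS]]; last first.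
  by exists (x, y); rewrite ?inE ?xS ?yS.
rewrite inE /= => /and3P[aS bS ab] E.
have ss z : z \in [set x; y] -> z \in S.
  by rewrite E !inE => /orP[]/eqP->.
by rewrite !ss // !inE eqxx ?orbT.
Qed.

(** A copy of a complete graph is determined by its vertex set, which turns sums over copies into
    sums over [r]-cliques. *)
Lemma mem_copies H : (H \in copies (complete_graph r) G) =
  [&& #|H.1| == r, clique H.1 & H == clique_copy H.1].
Proof.
rewrite inE; apply/andP/and3P.
  move=> [/andP[/subsetP sE _] /existsP[f /and3P[/injectiveP f_inj /eqP fV /eqP fE]]].
  have mE x y : x \in H.1 -> y \in H.1 -> x != y -> [set x; y] \in H.2.
    rewrite -fV -fE => /imsetP[a _ ->] /imsetP[b _ ->] fab.
    apply/imsetP; exists [set a; b]; last by rewrite imsetU1 imset_set1.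
    apply/imsetP; exists (a, b); rewrite ?inE //=.
    by rewrite /complete_adj; apply: contraNneq fab => ->.
  split.
  - by rewrite -fV card_imset // card_ord.
  - apply/cliqueP => x y xH yH xy.
    have /sE/edgeP[a [b [ab E]]] := mE _ _ xH yH xy.
    have xab : x \in [set a; b] by rewrite -E !inE eqxx.
    have yab : y \in [set a; b] by rewrite -E !inE eqxx orbT.
    move: xab yab xy; rewrite !inE => /orP[]/eqP-> /orP[]/eqP->; rewrite ?eqxx //.
    by rewrite adj_sym.
  rewrite [H]surjective_pairing xpair_eqE eqxx /=; apply/eqP/setP => e.
  apply/idP/imsetP => [|[[x y]]]; last first.
    by rewrite inE /= => /and3P[xH yH xy] ->; apply: mE.
  rewrite -fE => /imsetP[_ /imsetP[[a b] ab ->] ->].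
  exists (f a, f b); last by rewrite imsetU1 imset_set1.
  rewrite inE /= -fV !imset_f //=; move: ab; rewrite inE /=.
  by apply: contraNneq => /f_inj ->.
case: H => S E /= [/eqP szS /cliqueP cS /eqP[->]].
split.
  apply/andP; split.
    apply/subsetP => _ /imsetP[[x y] + ->]; rewrite inE /= => /and3P[xS yS xy].
    by apply/edgeP; exists x, y; split => //; apply: cS.
  apply/forall_inP => _ /imsetP[[x y] + ->]; rewrite inE /= => /and3P[xS yS _].
  by rewrite subUset !sub1set xS yS.
have rS : r = #|S| by rewrite szS.
pose f := [ffun i : 'I_r => enum_val (cast_ord rS i)].
have f_inj : injective f.
  by move=> i j; rewrite !ffunE => /enum_val_inj/cast_ord_inj.
have fV : [set f x | x : complete_graph r] = S.
  apply/setP => x; apply/imsetP/idP => [[i _ ->]|xS].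
    by rewrite ffunE enum_valP.
  exists (cast_ord (esym rS) (enum_rank_in xS x)) => //.
  by rewrite ffunE cast_ordKV enum_rankK_in.
apply/existsP; exists f; apply/and3P; split => /=.
- exact/injectiveP.
- by rewrite fV.
apply/eqP/setP => e; apply/imsetP/imsetP.
  move=> [_ /imsetP[[a b] ab ->] ->].
  exists (f a, f b); last by rewrite imsetU1 imset_set1.
  rewrite inE /= -{1 2}fV !imset_f //=; move: ab; rewrite inE /=.
  by apply: contraNneq => /f_inj ->.
move=> [[x y]]; rewrite inE /= -{1 2}fV => /and3P[/imsetP[a _ ->] /imsetP[b _ ->] ab] ->.
exists [set a; b]; last by rewrite imsetU1 imset_set1.
apply/imsetP; exists (a, b); rewrite ?inE //=.
by rewrite /complete_adj; apply: contraNneq ab => ->.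
Qed.

Lemma fractional_decomposition_of_cone (R : realType) : (1 < r)%N ->
  @clique_cone R G r (fun _ _ => 1) ->
  has_fractional_decomposition R (complete_graph r) G.
Proof.
move=> r1 [w w0 wE].
have sumE (x y : G) : adj x y ->
    \sum_(H in copies (complete_graph r) G | [set x; y] \in H.2) w H.1 = 1.
  move=> xy; have xny : x != y by apply: contraTneq xy => ->; rewrite adj_irrefl.
  rewrite -(wE x y xy) (reindex_onto clique_copy fst) /=.
    apply: eq_bigl => S; rewrite mem_copies mem_clique_copy //= !eqxx !andbT.
    by rewrite -!andbA.
  by move=> H /andP[]; rewrite mem_copies => /and3P[_ _ /eqP<-].
exists (fun H => w H.1); split=> [H Hc|e /edgeP[x [y [xy ->]]]]; last exact: sumE.
rewrite w0 /=; move: (Hc); rewrite mem_copies => /and3P[/eqP szH /cliqueP cH /eqP HE].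
(* The bound [w <= 1] follows from any edge of the copy: its nonnegative weights sum to 1. Such an
   edge exists as [1 < r]. *)
have /card_gt1P[x [y [xH yH xy]]] : (1 < #|H.1|)%N by rewrite szH.
rewrite -(sumE _ _ (cH _ _ xH yH xy)) (bigD1 H) /=.
  by rewrite lerDl sumr_ge0.
by rewrite Hc HE mem_clique_copy // xH.
Qed.

End Copies.

(** * From the minimum degree to the conflict bound *)

Lemma min_degree_le (G : sgraph) (x : G) : (min_degree G <= degree x)%N.
Proof.
rewrite /min_degree; have := mem_index_enum x.
elim: (index_enum _) => // y s IH; rewrite inE big_cons geq_min.
by move=> /orP[/eqP-> |/IH ->]; rewrite ?leqnn ?orbT.
Qed.

Theorem theorem1p3 (R : realType) (r n : nat) (G : sgraph) :
  (3 <= r)%N ->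
  (10 ^ 4 * r ^ 3 <= n)%N ->
  #|G| = n ->
  (1 - 1 / (10 ^+ 4 * r%:R `^ (3 / 2))) * n%:R <= (min_degree G)%:R :> R ->
  has_fractional_decomposition R (complete_graph r) G.
Proof.
move=> r3 rn Gn hdeg.
have r0 : 0 < r%:R :> R by rewrite ltr0n (leq_trans _ r3).
have G_gt0 : (0 < #|G|)%N.
  by rewrite Gn (leq_trans _ rn) // muln_gt0 !expn_gt0 (leq_trans _ r3).
pose eps : R := 1 / (10 ^+ 4 * r%:R `^ (3 / 2)).
apply: fractional_decomposition_of_cone; first exact: ltnW.
apply: (clique_cone1 r3 G_gt0 (eps := eps)) => [x|].
  (* The non-neighbours of [x], including [x] itself, are exactly the complement of its
     neighbourhood, so the degree bound yields [eps * n] without an extra 1. *)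
  have hx : (#|[set u | adj x u]| + #|[set u | ~~ adj x u]|)%N = n.
    rewrite -Gn -[RHS](cardsC [set u | adj x u]); congr (_ + _)%N.
    by apply: eq_card => u; rewrite !inE.
  have : (min_degree G)%:R <= (degree x)%:R :> R by rewrite ler_nat min_degree_le.
  have hxR : #|[set u | adj x u]|%:R + #|[set u | ~~ adj x u]|%:R = n%:R :> R.
    by rewrite -natrD hx.
  by move: hdeg; rewrite -/eps /degree Gn; lra.
(* Squaring removes the real exponent 3/2. *)
have -> : eps ^+ 2 = (10 ^+ 8 * r%:R ^+ 3)^-1.
  have rE : (r%:R `^ (3 / 2)) ^+ 2 = r%:R ^+ 3 :> R.
    rewrite -powR_mulrn ?powR_ge0 // -powRrM -powR_mulrn ?ltW //.
    by congr (_ `^ _); lra.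
  by rewrite /eps mul1r exprVn exprMn rE -exprM.
rewrite -mulrA [X in _ * X]mulrC mulVf //.
by rewrite gt_eqF // mulr_gt0 ?exprn_gt0.
Qed.
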